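(* For every $m\in\mathbb{N}=\{1,2,\dots\}$, the tangent numbers $T_{2m-1}$ satisfy $$T_{2m-1}=\sum_{k=0}^{m-1}(-1)^k\binom{2m}{k}(m-k)^{2m-1}+2\sum_{k=1}^{m-1}(-1)^k\sum_{\ell=0}^{m-k-1}(-1)^{\ell}\binom{2m}{\ell}(m-k-\ell)^{2m-1},$$ $$T_{2m-1}=(-1)^m\sum_{\ell=1}^{2m}(-1)^\ell\frac1{2^\ell}\Bigl(\frac1\ell-\frac1{2m+1}\Bigr)\binom{2m+1}{\ell}\sum_{q=0}^\ell\binom{\ell}{q}(2q-\ell)^{2m},$$ and the recurrence $$T_{2m+1}=\sum_{k=1}^m\binom{2m}{2k-1}T_{2k-1}T_{2(m-k)+1}.$$
   Context: The tangent numbers $T_{2k-1}$, $k\ge1$, are defined by the Maclaurin expansion $\tan x=\sum_{k=1}^\infty T_{2k-1}\frac{x^{2k-1}}{(2k-1)!}$ for $|x|<\frac\pi2$; that is, $T_{2k-1}$ is the $(2k-1)$-th derivative of $\tan$ at $0$. The first few, for $k=1,\dots,5$, are $1,2,16,272,7936$. Empty sums are $0$. *)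

(* Defs.v *)
From mathcomp Require Import all_boot all_order all_algebra.
From mathcomp Require Import all_classical all_reals all_analysis.
Import Order.TTheory GRing.Theory Num.Theory.
Import numFieldNormedType.Exports.

Set Implicit Arguments.
Unset Strict Implicit.
Unset Printing Implicit Defensive.

Local Open Scope ring_scope.

(* The n-th Maclaurin coefficient of tan times n!.  The tangent numbers are
   the values at odd n (the values at even n vanish, tan being odd). *)
Definition tangent_number (R : realType) (n : nat) : R :=
  derive1n n (@tan R) 0.

(* Main.v *)
(** On the open set where the cosine does not vanish, [V 0 = c tan (1 - u^k)] with [u 0 = 0]
forces [V] and [c tan] to have the same derivatives at [0] up to order [k - 1].  The two closed
formulas come from two choices of a trigonometric polynomial of this shape, with [k = 2m], whose
derivatives at [0] are read off termwise:
- the derivative of [sum_(1 <= l <= 2m) (-1)^l C(2m, l) cos^l x / l] is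
  [tan x (1 - (1 - cos x)^(2m))], and [cos^l] is a combination of the [cos ((2q - l) x)];
- with [B j = sum_(l <= m - j) C(2m+1, l)], multiplying
  [- sum_(1 <= j <= m) (-1)^j B j sin (2 j x)] by [2 cos x] makes it telescope to
  [2^(2m) (sin x - sin^(2m+1) x)].
The recurrence is the Leibniz formula applied to [tan' = 1 + tan^2], the tangent numbers of even
index being zero. *)

Require Import Defs.
From mathcomp Require Import all_boot all_order all_algebra.
From mathcomp Require Import all_classical all_reals all_analysis.
From mathcomp Require Import ring zify.
Import Order.TTheory GRing.Theory Num.Theory.
Import numFieldNormedType.Exports.

Set Implicit Arguments.
Unset Strict Implicit.
Unset Printing Implicit Defensive.

Local Open Scope ring_scope.

(** * Towers of successive derivatives *)

(* [F 0] is smooth on [A], with [F n] as its [n]-th derivative. *)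
Definition tower (R : realType) (A : set R) (F : nat -> R -> R) : Prop :=
  forall n x, A x -> is_derive x 1 (F n) (F n.+1 x).

(** A derivative depends only on the germ, and openness of [A] makes agreement on [A] local. A
    function can thus be differentiated in two ways and the results compared. *)
Lemma tower_unique (R : realType) (A : set R) (F G : nat -> R -> R) :
  open A -> tower A F -> tower A G -> (forall x, A x -> F 0%N x = G 0%N x) ->
  forall n x, A x -> F n x = G n x.
Proof.
move=> oA tF tG FG0; elim=> // n IHn x Ax.
have [_ <-] := tF n x Ax; have [_ <-] := tG n x Ax.
apply: near_eq_derive; have : \forall y \near x, A y by exact: open_nbhs_nbhs.
by apply: filterS => y; exact: IHn.
Qed.

Lemma tower_derive1n (R : realType) (A : set R) (F : nat -> R -> R) :
  open A -> tower A F -> forall n x, A x -> derive1n n (F 0%N) x = F n x.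
Proof.
move=> oA tF; elim=> // n IHn x Ax.
rewrite derive1nS derive1E; have [_ <-] := tF n x Ax.
apply: near_eq_derive; have : \forall y \near x, A y by exact: open_nbhs_nbhs.
by apply: filterS => y; exact: IHn.
Qed.

Lemma is_derive_sum_nat (R : realType) (a b : nat) (f : nat -> R -> R)
    (df : nat -> R) (x : R) :
  (forall i, is_derive x 1 (f i) (df i)) ->
  is_derive x 1 (fun y => \sum_(a <= i < b) f i y) (\sum_(a <= i < b) df i).
Proof.
move=> dfx; elim: b => [|b IHb].
  rewrite big_geq//; under eq_fun do rewrite big_geq//; exact: is_derive_cst.
have [ab|ba] := leqP a b.
  rewrite big_nat_recr//=; under eq_fun do rewrite big_nat_recr//=.
  exact: is_deriveD.
by rewrite big_geq//; under eq_fun do rewrite big_geq//; exact: is_derive_cst.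
Qed.

Lemma tower_sum (R : realType) (A : set R) (a b : nat) (c : nat -> R)
    (F : nat -> nat -> R -> R) :
  (forall i, tower A (F i)) ->
  tower A (fun n x => \sum_(a <= i < b) c i * F i n x).
Proof.
move=> tF n x Ax; apply: is_derive_sum_nat => i.
have dF := tF i n x Ax; exact: is_deriveZ.
Qed.

Definition leibniz (R : realType) (F G : nat -> R -> R) (n : nat) (x : R) : R :=
  \sum_(0 <= i < n.+1) 'C(n, i)%:R * (F i x * G (n - i)%N x).

Lemma tower_leibniz (R : realType) (A : set R) (F G : nat -> R -> R) :
  tower A F -> tower A G -> tower A (leibniz F G).
Proof.
move=> tF tG n x Ax.
have -> : leibniz F G n.+1 x = \sum_(0 <= i < n.+1) 'C(n, i)%:R *
    (F i x * G (n - i).+1 x + G (n - i)%N x * F i.+1 x).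
  rewrite /leibniz big_nat_recl//= bin0 subn0.
  under eq_bigr do rewrite binS natrD mulrDl.
  rewrite big_split/= big_nat_recr//= bin_small// mul0r addr0 addrA.
  under [RHS]eq_bigr do rewrite mulrDr.
  rewrite big_split/=; congr (_ + _).
    rewrite [RHS]big_nat_recl//= bin0 subn0; congr (_ + _).
    by apply: eq_big_nat => i /andP[_ i_n]; rewrite subSS subnSK.
  by apply: eq_bigr => i _; rewrite subSS [G _ _ * _]mulrC.
apply: is_derive_sum_nat => i.
have dF := tF i x Ax; have dG := tG (n - i)%N x Ax.
apply: is_deriveZ.
Qed.

(** Induction on [k] by the Leibniz formula: at [a] the term [i = 0] has the factor [F 0 a = 0], and
    every other term differentiates the lower power fewer than [k] times. *)
Lemma tower_pow (R : realType) (A : set R) (F : nat -> R -> R) (a : R) (k : nat) :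
  tower A F -> F 0%N a = 0 ->
  exists G, [/\ tower A G, forall x, G 0%N x = F 0%N x ^+ k
    & forall n, (n < k)%N -> G n a = 0].
Proof.
move=> tF Fa; elim: k => [|k [G [tG G0 Ga]]].
  exists (fun n x => (n == 0)%:R); split => // n x _; exact: is_derive_cst.
exists (leibniz F G); split; first exact: tower_leibniz.
  by move=> x; rewrite /leibniz big_nat1 bin0 mul1r subnn G0 exprS.
move=> n nk; rewrite /leibniz big_nat big1// => -[|i] /andP[_ i_n].
  by rewrite Fa mul0r mulr0.
by rewrite Ga ?mulr0//; lia.
Qed.

(** * Waves, and the tangent away from the zeros of the cosine *)

(* The [n]-th derivative of [cos (a x + b)]. *)
Definition wave (R : realType) (a b : R) (n : nat) (x : R) : R :=
  a ^+ n * cos (a * x + b + (pi / 2) *+ n).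

Lemma wave_tower (R : realType) (A : set R) (a b : R) : tower A (wave a b).
Proof.
move=> n x _; rewrite /wave.
apply: is_derive_eq.
rewrite exprSr [_ *+ n.+1]mulrSr addrA cosDpihalf.
rewrite /GRing.scale /=; ring.
Qed.

Definition cos_ne0 {R : realType} : set R := [set x | cos x != 0].

Lemma open_cos_ne0 (R : realType) : open (@cos_ne0 R).
Proof.
rewrite (_ : cos_ne0 = (cos @^-1` [set y | y != 0])%classic)//.
apply: open_comp => [x _|]; first exact: continuous_cos.
exact: open_neq.
Qed.

(* Since [tan' = 1 + tan^2], the [n]-th derivative of [tan] is a polynomial in [tan]. *)
Fixpoint tan_poly (R : realType) (n : nat) : {poly R} :=
  if n is n'.+1 then (1 + 'X ^+ 2) * (tan_poly R n')^`() else 'X.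

Definition tan_tower {R : realType} (n : nat) (x : R) : R :=
  (tan_poly R n).[tan x].

Lemma tower_tan (R : realType) : tower cos_ne0 (@tan_tower R).
Proof.
move=> n x cx; rewrite /tan_tower /= !hornerE.
have dt := is_derive_tan cx.
have dp := is_derive_poly (tan_poly R n) (tan x).
have := is_derive1_comp dp dt.
by rewrite cos2_tan2 // mulrC.
Qed.

Lemma tangent_numberE (R : realType) (n : nat) :
  tangent_number R n = tan_tower n 0.
Proof.
rewrite -(tower_derive1n (@open_cos_ne0 R) (@tower_tan R)); last first.
  by rewrite /cos_ne0/= cos0 oner_eq0.
by congr derive1n; apply/funext => x; rewrite /tan_tower hornerX.
Qed.

(** By Leibniz, every derivative of [tan * U^k] at [0] of order below [k] contains a derivative of
    [U^k] of order below [k], which is zero. *)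
Lemma tower_tan_perturbed (R : realType) (U V : nat -> R -> R) (c : R) (k : nat) :
  tower cos_ne0 U -> U 0%N 0 = 0 -> tower cos_ne0 V ->
  (forall x, cos x != 0 -> V 0%N x = c * (tan x * (1 - U 0%N x ^+ k))) ->
  forall n, (n < k)%N -> V n 0 = c * tangent_number R n.
Proof.
move=> tU U0 tV V0 n nk.
have [W [tW W0 Wa]] := tower_pow k tU U0.
(* [c tan - c tan U^k] is presented as a two-term linear combination, so that [tower_sum]
   applies. *)
pose d (i : nat) : R := if i is 0%N then c else - c.
pose H (i : nat) := if i is 0%N then tan_tower else leibniz (@tan_tower R) W.
have tH : tower cos_ne0 (fun n x => \sum_(0 <= i < 2) d i * H i n x).
  apply: tower_sum => -[|i]; [exact: tower_tan|].
  exact: tower_leibniz (@tower_tan R) tW.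
rewrite (tower_unique (@open_cos_ne0 R) tV tH) => [|x cx|].
- rewrite 2?big_nat_recr//= big_geq// add0r /leibniz big_nat big1.
    by rewrite mulr0 addr0 tangent_numberE.
  by move=> i /andP[_ i_n]; rewrite Wa ?mulr0//; lia.
- rewrite V0// 2?big_nat_recr//= big_geq// add0r /leibniz big_nat1 bin0 subnn W0.
  by rewrite /tan_tower hornerX; ring.
- by rewrite /cos_ne0/= cos0 oner_eq0.
Qed.

(** * The recurrence *)

Lemma tangent_numberS (R : realType) (n : nat) :
  tangent_number R n.+1 = (n == 0)%:R +
    \sum_(0 <= i < n.+1)
      'C(n, i)%:R * (tangent_number R i * tangent_number R (n - i)).
Proof.
(* The tower of [1 + tan^2]; the Boolean term is the [n]-th derivative of the constant [1]. *)
pose K (n : nat) (x : R) := (n == 0)%:R + leibniz (@tan_tower R) (@tan_tower R) n x.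
have tK : tower cos_ne0 K.
  move=> i x cx; have := tower_leibniz (@tower_tan R) (@tower_tan R) i cx.
  move=> dl; have := is_deriveD (is_derive_cst ((i == 0)%:R : R) x 1) dl.
  by [].
have tS : tower cos_ne0 (fun n => @tan_tower R n.+1).
  by move=> i; exact: tower_tan.
rewrite tangent_numberE (tower_unique (@open_cos_ne0 R) tS tK) => [|x cx|].
- by rewrite /K /leibniz; under [in RHS]eq_bigr do rewrite !tangent_numberE.
- rewrite /K /leibniz big_nat1 /tan_tower/= derivX mulr1 hornerD hornerC hornerXn.
  by rewrite bin0 mul1r hornerX expr2.
- by rewrite /cos_ne0/= cos0 oner_eq0.
Qed.

Lemma tangent_number_even (R : realType) (n : nat) :
  tangent_number R (2 * n) = 0.
Proof.
have [k] := ubnP n; elim: k n => // k IHk [|n] nk.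
  by rewrite tangent_numberE /tan_tower hornerX tan0.
rewrite (_ : (2 * n.+1)%N = (2 * n).+2) ?tangent_numberS/=; last lia.
(* The indices [i] and [2n + 1 - i] have an odd sum, so one of them is even and the induction
   hypothesis kills the product. *)
rewrite add0r big_nat big1// => i /andP[_ i_n].
have := odd_double_half i; case: (odd i) => /= iE.
  rewrite [X in _ * (_ * tangent_number R X)](_ : _ = 2 * (n - i./2))%N; last lia.
  by rewrite IHk ?mulr0//; lia.
rewrite [X in _ * (tangent_number R X * _)](_ : _ = 2 * i./2)%N; last lia.
by rewrite IHk ?mul0r ?mulr0//; lia.
Qed.

Lemma tangent_number_rec (R : realType) (m : nat) (m_gt0 : (1 <= m)%N) :
  tangent_number R (2 * m + 1) =
    \sum_(1 <= k < m.+1)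
       'C(2 * m, 2 * k - 1)%:R
         * tangent_number R (2 * k - 1)
         * tangent_number R (2 * (m - k) + 1).
Proof.
rewrite addn1 tangent_numberS (_ : (2 * m == 0)%N = false) ?add0r; last lia.
pose f i := 'C(2 * m, i)%:R * (tangent_number R i * tangent_number R (2 * m - i)).
rewrite -[LHS]/(\sum_(0 <= i < (2 * m).+1) f i).
have split_parity p : \sum_(0 <= i < (2 * p).+1) f i =
    f 0%N + \sum_(1 <= k < p.+1) (f (2 * k - 1)%N + f (2 * k)%N).
  elim: p => [|p IHp]; first by rewrite big_nat1 big_geq// addr0.
  rewrite (_ : (2 * p.+1).+1 = (2 * p).+3); last lia.
  rewrite !(big_nat_recr (2 * p).+1, big_nat_recr (2 * p).+2)//= IHp.
  rewrite [in RHS]big_nat_recr//= -!addrA; do 3?congr (_ + _); congr f; lia.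
rewrite split_parity {1}/f (tangent_number_even R 0) mul0r mulr0 add0r.
apply: eq_big_nat => k /andP[k_gt0 km].
rewrite /f tangent_number_even mul0r mulr0 addr0 mulrA.
by do 2?congr (_ * _); congr tangent_number; lia.
Qed.

(** * Powers of sine and cosine as sums of waves *)

Lemma cosX_expand (R : realType) (l : nat) (z : R) :
  (2 * cos z) ^+ l =
    \sum_(0 <= q < l.+1) 'C(l, q)%:R * cos ((2 * q%:R - l%:R) * z).
Proof.
elim: l => [|l IHl].
  by rewrite big_nat1 bin0 mulr0 subrr mul0r cos0 mulr1.
have step q : 2 * cos z * cos ((2 * q%:R - l%:R) * z) =
    cos ((2 * q%:R - l.+1%:R) * z) + cos ((2 * q.+1%:R - l.+1%:R) * z).
  rewrite (_ : (2 * q%:R - l.+1%:R) * z = (2 * q%:R - l%:R) * z - z); last first.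
    by rewrite -natr1; ring.
  rewrite (_ : (2 * q.+1%:R - l.+1%:R) * z = (2 * q%:R - l%:R) * z + z); last first.
    by rewrite -!natr1; ring.
  by rewrite cosB cosD; ring.
rewrite exprS IHl big_distrr/=.
under eq_bigr do rewrite mulrCA step mulrDr.
rewrite big_split/= big_nat_recl//= [RHS]big_nat_recl//= !bin0 -addrA; congr (_ + _).
under [RHS]eq_bigr do rewrite binS natrD mulrDl.
by rewrite [RHS]big_split/= [X in _ = X + _]big_nat_recr//= bin_small// mul0r addr0.
Qed.

(** The even number of indices is symmetric about [m + 1/2], which pairs [m + 1 + j] with
    [m - j]. *)
Lemma sum_fold_middle (R : realType) (m : nat) (f : nat -> R) :
  (forall j, (j <= m)%N -> f (m.+1 + j)%N = f (m - j)%N) ->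
  \sum_(0 <= q < (2 * m).+2) f q = 2 * \sum_(0 <= j < m.+1) f (m - j)%N.
Proof.
move=> fE; rewrite (big_cat_nat (n := m.+1))//=; last lia.
rewrite big_nat_rev/= add0n mulr_natl mulr2n; congr (_ + _).
rewrite -{1}[m.+1]add0n big_addn (_ : (2 * m).+2 - m.+1 = m.+1)%N; last lia.
by apply: eq_big_nat => j /andP[_ jm]; rewrite addnC fE.
Qed.

Lemma sum_bin_half (R : realType) (m : nat) :
  \sum_(0 <= j < m.+1) 'C((2 * m).+1, m - j)%:R = 2 ^+ (2 * m) :> R.
Proof.
apply: (@mulfI _ 2) => //; rewrite -exprS.
rewrite -(@sum_fold_middle R m (fun q => 'C((2 * m).+1, q)%:R)) => [|j jm].
  have := cosX_expand (2 * m).+1 (0 : R); rewrite cos0 mulr1 => ->.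
  by apply: eq_bigr => q _; rewrite mulr0 cos0 mulr1.
by rewrite -bin_sub; [congr (_%:R); congr binomial; lia|lia].
Qed.

Lemma sinD_pi_mul (R : realType) (x : R) (j : nat) :
  sin (x + pi *+ j) = (-1) ^+ j * sin x.
Proof.
elim: j => [|j IHj]; first by rewrite addr0 mul1r.
by rewrite mulrSr addrA sinDpi IHj exprS mulN1r mulNr.
Qed.

(** This is [cosX_expand] at [y - pi / 2], folded: the terms [q = m - j] and [q = m + 1 + j] have
    opposite frequencies and equal cosines. *)
Lemma sinX_expand (R : realType) (m : nat) (y : R) :
  2 ^+ (2 * m) * sin y ^+ (2 * m).+1 =
    \sum_(0 <= j < m.+1)
      (-1) ^+ j * 'C((2 * m).+1, m - j)%:R * sin ((2 * j + 1)%:R * y).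
Proof.
apply: (@mulfI _ 2) => //; rewrite mulrA -exprS -exprMn -cosBpihalf cosX_expand.
rewrite (@sum_fold_middle R m) => [|j jm]; last first.
  rewrite -(@bin_sub _ (m.+1 + j)); last lia.
  rewrite (_ : (2 * m).+1 - (m.+1 + j) = m - j)%N; last lia.
  congr (_ * _); rewrite -cosN; congr cos.
  rewrite natrB// natrD -[(2 * m).+1%:R]natr1 -[m.+1%:R]natr1 natrM; ring.
congr (_ * _); apply: eq_big_nat => j /andP[_ jm].
rewrite mulrAC mulrC; congr (_ * _).
rewrite (_ : _ * _ = - ((2 * j + 1)%:R * y - pi / 2 - pi *+ j)); last first.
  rewrite natrB// -[(2 * m).+1%:R]natr1 natrD !natrM -mulr_natr; by field.
rewrite cosN addrAC cosBpihalf.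
by rewrite -[in RHS](subrK (pi *+ j) (_ * y)) sinD_pi_mul signrMK.
Qed.

Lemma cos_pi_mul (R : realType) (j : nat) : cos (pi *+ j) = (-1) ^+ j :> R.
Proof.
by rewrite -sinDpihalf addrC sinD_pi_mul sin_pihalf mulr1.
Qed.

Lemma pihalf_mul2n (R : realType) (j : nat) : (pi / 2) *+ (2 * j) = pi *+ j :> R.
Proof. by rewrite mulrnA -[_ *+ 2]mulr_natr divfK. Qed.

(** * The formula from powers of the cosine *)

Lemma bin_div_sub (R : realType) (n l : nat) : (0 < l <= n)%N ->
  (1 / l%:R - 1 / (n + 1)%:R) * 'C(n + 1, l)%:R = 'C(n, l)%:R / l%:R :> R.
Proof.
move=> /andP[l0 ln].
have := mul_bin_down n.+1 l; rewrite /= => /(congr1 (fun k => k%:R : R)).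
rewrite !natrM natrB ?leqW// addn1 => E.
have l_neq0 : l%:R != 0 :> R by rewrite pnatr_eq0 -lt0n.
have n_neq0 : n.+1%:R != 0 :> R by rewrite pnatr_eq0.
apply: (mulfI n_neq0); rewrite mulrA [RHS]mulrA E.
by field; rewrite l_neq0 addrC natr1.
Qed.

Lemma tangent_number_cos (R : realType) (m : nat) (hm : (1 <= m)%N) :
  tangent_number R (2 * m - 1) =
    (-1) ^+ m * \sum_(1 <= l < (2 * m).+1)
       (-1) ^+ l * (1 / 2 ^+ l) * (1 / l%:R - 1 / (2 * m + 1)%:R)
         * 'C(2 * m + 1, l)%:R
         * \sum_(0 <= q < l.+1)
              'C(l, q)%:R * (2 * q%:R - l%:R) ^+ (2 * m).
Proof.
pose c l : R := (-1) ^+ l * 'C(2 * m, l)%:R / l%:R.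
pose P l (n : nat) (x : R) :=
  \sum_(0 <= q < l.+1) 'C(l, q)%:R / 2 ^+ l * wave (2 * q%:R - l%:R) 0 n x.
pose L (n : nat) (x : R) := \sum_(1 <= l < (2 * m).+1) c l * P l n x.
(* [1 - cos x], the constant being the wave of frequency [0]. *)
pose U (n : nat) (x : R) : R := \sum_(0 <= i < 2) (-1) ^+ i * wave i%:R 0 n x.
have tP l : tower cos_ne0 (P l) by apply: tower_sum => q; exact: wave_tower.
have tL : tower cos_ne0 L by apply: tower_sum => l; exact: tP.
have tU : tower cos_ne0 U by apply: tower_sum => q; exact: wave_tower.
have P0 l x : P l 0%N x = cos x ^+ l.
  have two_neq0 : (2 ^+ l : R) != 0 by rewrite expf_neq0.
  apply: (mulfI two_neq0); rewrite -exprMn cosX_expand /P big_distrr/=.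
  apply: eq_bigr => q _.
  rewrite mulrCA mulrA divfK//; congr (_ * _).
  by rewrite /wave expr0 mul1r mulr0n !addr0.
have U0 x : U 0%N x = 1 - cos x.
  rewrite /U 2?big_nat_recr//= big_geq// /wave !expr0 expr1 !addr0 !mul1r.
  by rewrite mul0r cos0 add0r mulN1r.
(* [L 1] is identified by differentiating the powers of [cos] directly; the binomial theorem then
   gives [(1 - cos x)^(2m)] without its constant term. *)
have V0 x : cos x != 0 -> L 1%N x = 1 * (tan x * (1 - U 0%N x ^+ (2 * m))).
  move=> cx; have dL1 : is_derive x 1 (L 0%N) (L 1%N x) by exact: tL.
  have dL : is_derive x 1 (fun y => \sum_(1 <= l < (2 * m).+1) c l * cos y ^+ l)
      (\sum_(1 <= l < (2 * m).+1) c l * (l%:R * cos x ^+ l.-1 * - sin x)).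
    apply: is_derive_sum_nat => l; apply: is_deriveZ.
    by have := is_deriveX l (is_derive_cos x); rewrite exprfctE.
  have L0 : L 0%N = fun y => \sum_(1 <= l < (2 * m).+1) c l * cos y ^+ l.
    by apply/funext => y; apply: eq_bigr => l _; rewrite P0.
  rewrite -(@derive_val _ _ _ _ _ _ _ dL1) L0 (@derive_val _ _ _ _ _ _ _ dL) U0 mul1r.
  rewrite exprBn -(big_mkord xpredT (fun i => ((-1) ^+ i * 1 ^+ (2 * m - i) * cos x ^+ i) *+ 'C(2 * m, i))).
  rewrite big_nat_recl//= opprD addrA !expr0 mulr1 mul1r expr1n bin0 subrr add0r.
  rewrite big_add1/= -sumrN big_distrr/=; apply: eq_bigr => l _.
  rewrite /c /tan expr1n mulr1 -mulr_natr [cos x ^+ _.+1]exprS.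
  by field; rewrite cx addrC natr1 pnatr_eq0.
(* The shift turns order [2m - 1] for [tan] into order [2m] for [L], hence the exponent [2m] and the
   sign [cos (m pi)]. *)
have tV : tower cos_ne0 (fun n => L n.+1) by move=> n; exact: tL.
rewrite -[LHS]mul1r -(tower_tan_perturbed (k := 2 * m) tU _ tV V0); [|by rewrite U0 cos0 subrr|lia].
rewrite (_ : (2 * m - 1).+1 = 2 * m)%N; last lia.
rewrite /L big_distrr/=; apply: eq_big_nat => l /andP[l_gt0 lm].
rewrite -[_ * _ * (_ - _) * _]mulrA bin_div_sub ?l_gt0//.
rewrite /P !big_distrr/=; apply: eq_bigr => q _.
rewrite /wave mulr0 !add0r pihalf_mul2n cos_pi_mul /c.
by field; rewrite pnatr_eq0 -lt0n l_gt0 expf_neq0.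
Qed.

(** * The formula from partial binomial sums *)

Definition partial_bin (n k : nat) : nat := (\sum_(0 <= l < k) 'C(n, l))%N.

Lemma partial_binS (n k : nat) :
  partial_bin n.+1 k.+1 = ('C(n, k) + 2 * partial_bin n k)%N.
Proof.
rewrite /partial_bin big_nat_recl//= bin0; under eq_bigr do rewrite binS.
rewrite big_split/= addnA mul2n -addnn addnA; congr (_ + _)%N.
transitivity (\sum_(0 <= l < k.+1) 'C(n, l))%N; first by rewrite big_nat_recl//= bin0.
by rewrite big_nat_recr//= addnC.
Qed.

(** Setting [i = k + l] and exchanging the sums, the inner sum of ['C(n, i - k)] over [1 <= k <= i]
    is [partial_bin n i]; [partial_binS] absorbs the single sum. *)
Lemma double_sum_partial_bin (R : realType) (m n e : nat) (hm : (0 < m)%N) :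
  \sum_(0 <= k < m) (-1) ^+ k * 'C(n, k)%:R * (m%:R - k%:R) ^+ e
  + 2 * \sum_(1 <= k < m) (-1) ^+ k *
      \sum_(0 <= l < m - k) (-1) ^+ l * 'C(n, l)%:R * (m%:R - k%:R - l%:R) ^+ e
  = \sum_(0 <= i < m) (-1) ^+ i * (partial_bin n.+1 i.+1)%:R * (m%:R - i%:R) ^+ e
  :> R.
Proof.
under [RHS]eq_bigr do rewrite partial_binS natrD natrM mulrDr mulrDl.
rewrite [RHS]big_split/=; congr (_ + _); rewrite big_distrr/=.
have pb0 : partial_bin n 0 = 0%N by rewrite /partial_bin big_geq.
rewrite [RHS](big_ltn hm) pb0 !mulr0 mul0r add0r.
pose h (k i : nat) : R := 2 * ((-1) ^+ i * 'C(n, i - k)%:R * (m%:R - i%:R) ^+ e).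
transitivity (\sum_(1 <= k < m) \sum_(1 <= i < m | (k <= i)%N) h k i).
  apply: eq_big_nat => k /andP[k_gt0 km].
  rewrite -(big_nat_widenl k 1 m xpredT)//.
  have := @big_addn R 0 +%R 0 m k xpredT (h k); rewrite add0n => ->; rewrite !big_distrr/=.
  apply: eq_bigr => l _.
  by rewrite /h addnK natrD exprD opprD addrA [m%:R - l%:R - _]addrAC; ring.
rewrite (exchange_big_dep_nat xpredT)//=; apply: eq_big_nat => i /andP[i_gt0 im].
rewrite -(big_nat_widen 1 i.+1 m xpredT)// big_add1/=.
rewrite /partial_bin natr_sum big_nat_rev/= add0n !big_distrr/= big_distrl/=.
apply: eq_big_nat => k /andP[_ ki]; rewrite /h (_ : i - (i - k.+1).+1 = k)%N; last lia.
by ring.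
Qed.

Lemma tangent_number_sin (R : realType) (m : nat) (hm : (1 <= m)%N) :
  tangent_number R (2 * m - 1) =
    \sum_(0 <= i < m) (-1) ^+ i * (partial_bin (2 * m).+1 i.+1)%:R
      * (m%:R - i%:R) ^+ (2 * m - 1).
Proof.
pose b j : R := (partial_bin (2 * m).+1 (m.+1 - j))%:R.
pose s j (y : R) := sin ((2 * j + 1)%:R * y).
(* The phase [- (pi / 2)] turns the cosine waves into [sin (2 j y)]. *)
pose G (n : nat) (y : R) :=
  \sum_(1 <= j < m.+1) - ((-1) ^+ j * b j) * wave (2 * j)%:R (- (pi / 2)) n y.
(* Dividing the telescoped [2^(2m) (sin y - sin^(2m+1) y)] by [2 cos y] leaves
   [c tan y (1 - sin^(2m) y)]. *)
pose c : R := 2 ^+ (2 * m - 1).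
have c2 : 2 * c = 2 ^+ (2 * m) by rewrite /c -exprS; congr (_ ^+ _); lia.
have tG : tower cos_ne0 G by apply: tower_sum => j; exact: wave_tower.
have tU : tower cos_ne0 (wave (1 : R) (- (pi / 2))) by exact: wave_tower.
have U0 x : wave 1 (- (pi / 2)) 0 x = sin x :> R.
  by rewrite /wave expr0 !mul1r addr0 cosBpihalf.
have b0 : b 0%N = 2 ^+ (2 * m).
  rewrite -sum_bin_half /b /partial_bin subn0 natr_sum big_nat_rev/=.
  by apply: eq_bigr => j _; rewrite add0n subSS.
have bS j : (j < m.+1)%N -> b j - b j.+1 = 'C((2 * m).+1, m - j)%:R.
  move=> jm; rewrite /b /partial_bin subSn// subSS big_nat_recr//= natrD.
  by rewrite addrC addrA addNr add0r.
have bm : b m.+1 = 0 by rewrite /b subnn /partial_bin big_geq.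
have G0 y : cos y != 0 -> G 0%N y = c * (tan y * (1 - wave 1 (- (pi / 2)) 0 y ^+ (2 * m))).
  move=> cy; rewrite U0; apply: (@mulfI _ (2 * cos y)); first by rewrite mulf_neq0.
  (* The right-hand side is what remains after telescoping, and [sinX_expand] evaluates it. *)
  transitivity (b 0%N * s 0%N y - \sum_(0 <= j < m.+1) (-1) ^+ j * (b j - b j.+1) * s j y).
    have step j : 2 * cos y * (- ((-1) ^+ j.+1 * b j.+1) * wave (2 * j.+1)%:R (- (pi / 2)) 0 y)
        = (-1) ^+ j * b j.+1 * (s j y + s j.+1 y).
      rewrite /wave expr0 mul1r addr0 cosBpihalf /s.
      rewrite (_ : (2 * j + 1)%:R * y = (2 * j.+1)%:R * y - y); last first.
        by rewrite natrD !natrM -natr1; ring.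
      rewrite (_ : (2 * j.+1 + 1)%:R * y = (2 * j.+1)%:R * y + y); last first.
        by rewrite natrD mulrDl mul1r.
      by rewrite sinB sinD exprS; ring.
    rewrite /G big_distrr/= big_add1/=; under eq_bigr do rewrite step mulrDr.
    under [in RHS]eq_bigr do rewrite mulrBr mulrBl.
    rewrite sumrB big_split/= opprB addrA.
    rewrite [X in _ = _ + X - _]big_nat_recr//= bm mulr0 mul0r addr0.
    rewrite [X in _ = _ - X]big_nat_recl//= expr0 mul1r opprD addrACA subrr add0r.
    congr (_ + _); rewrite -sumrN.
    by apply: eq_bigr => j _; rewrite exprS mulN1r !mulNr opprK.
  under eq_big_nat do rewrite bS//.
  rewrite -sinX_expand b0 -c2 /s mul1r /tan exprS; by field.
have c_neq0 : c != 0 by rewrite expf_neq0.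
apply: (mulfI c_neq0).
rewrite -(tower_tan_perturbed (k := 2 * m) tU _ tG G0); [|by rewrite U0 sin0|lia].
(* Reversal substitutes [j = m - i], so the coefficient [b j] becomes
   [partial_bin (2 * m).+1 i.+1]. *)
rewrite /G big_add1/= big_nat_rev/= add0n big_distrr/=.
apply: eq_big_nat => i /andP[_ im].
rewrite (_ : (m - i.+1).+1 = m - i)%N; last lia.
rewrite /b (_ : m.+1 - (m - i) = i.+1)%N; last lia.
rewrite /wave mulr0 add0r natrM exprMn natrB ?(ltnW im)//.
(* The [2m - 1] quarter turns of the derivative and the initial phase add up to [(m - 1) pi]. *)
rewrite (_ : - (pi / 2) + _ = pi *+ m.-1 :> R); last first.
  rewrite -pihalf_mul2n [in LHS](_ : 2 * m - 1 = (2 * m.-1).+1)%N; last lia.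
  by rewrite [pi / 2 *+ _.+1]mulrS addKr.
rewrite cos_pi_mul -/c.
have -> : (-1) ^+ i = - (-1) ^+ (m - i) * (-1) ^+ m.-1 :> R.
  rewrite mulNr -exprD -[RHS]mulN1r -exprS.
  rewrite -[LHS]signr_odd -[RHS]signr_odd; congr (_ ^+ _); lia.
by field.
Qed.

Unset Implicit Arguments.

Theorem theorem1p3 (R : realType) (m : nat) (hm : (1 <= m)%N) :
  [/\ tangent_number R (2 * m - 1) =
        \sum_(0 <= k < m)
           (-1) ^+ k * 'C(2 * m, k)%:R * (m%:R - k%:R) ^+ (2 * m - 1)
        + 2 * \sum_(1 <= k < m)
           (-1) ^+ k * \sum_(0 <= l < m - k)
              (-1) ^+ l * 'C(2 * m, l)%:R
                * (m%:R - k%:R - l%:R) ^+ (2 * m - 1),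
      tangent_number R (2 * m - 1) =
        (-1) ^+ m * \sum_(1 <= l < (2 * m).+1)
           (-1) ^+ l * (1 / 2 ^+ l) * (1 / l%:R - 1 / (2 * m + 1)%:R)
             * 'C(2 * m + 1, l)%:R
             * \sum_(0 <= q < l.+1)
                  'C(l, q)%:R * (2 * q%:R - l%:R) ^+ (2 * m)
    & tangent_number R (2 * m + 1) =
        \sum_(1 <= k < m.+1)
           'C(2 * m, 2 * k - 1)%:R
             * tangent_number R (2 * k - 1)
             * tangent_number R (2 * (m - k) + 1)].
Proof.
split; [|exact: tangent_number_cos|exact: tangent_number_rec].
by rewrite double_sum_partial_bin// tangent_number_sin.
Qed.
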